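(* Let $R$ be an integral domain. Then the following are equivalent: (1) $R$ is a discrete valuation ring (DVR). (2) $R$ is a PID with a unique nonzero prime ideal. (3) $R$ is a PID with a unique nonzero maximal ideal.
   Context: All rings are commutative with unity. A discrete valuation of a field $K$ is a surjective group homomorphism $v\colon K^\times \to \mathbb{Z}$ (from the multiplicative group of $K$ to the additive group $\mathbb{Z}$) such that $v(x+y)\ge \min\{v(x),v(y)\}$ for all $x,y\in K^\times$ with $x+y\neq 0$; by convention $v(0)=\infty$. A discrete valuation ring (DVR) is any ring of the form $\mathcal{O}_v=\{x\in K \mid v(x)\ge 0\}$, where $K$ is a field and $v$ is a discrete valuation of $K$. ''A unique nonzero prime (maximal) ideal'' means that exactly one nonzero prime (maximal) ideal exists. *)

(* Defs.v *)
From mathcomp Require Import all_boot all_order all_algebra.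

Set Implicit Arguments.
Unset Strict Implicit.
Unset Printing Implicit Defensive.

Import Order.TTheory GRing.Theory Num.Theory.
Local Open Scope ring_scope.

(* Only the values of v on nonzero elements are meaningful: v is a map        *)
(* K^* -> Z, and v 0 is an arbitrary junk value standing for v(0) = oo, which *)
(* is why the case x = 0 is treated apart in valuation_ring.                  *)
Definition discrete_valuation (K : fieldType) (v : K -> int) : Prop :=
  [/\ forall x y, x != 0 -> y != 0 -> v (x * y) = v x + v y,
      forall n : int, exists2 x, x != 0 & v x = n
    & forall x y, x != 0 -> y != 0 -> x + y != 0 ->
        Num.min (v x) (v y) <= v (x + y)].

Definition valuation_ring (K : fieldType) (v : K -> int) : {pred K} :=
  [pred x | (x == 0) || (0 <= v x)].

(* R is isomorphic to the subring valuation_ring v of K; the isomorphism is   *)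
(* given as an injective ring morphism into K with image valuation_ring v.    *)
Definition is_DVR (R : idomainType) : Prop :=
  exists (K : fieldType) (v : K -> int) (phi : {rmorphism R -> K}),
    [/\ discrete_valuation v, injective phi
      & forall x, x \in valuation_ring v <-> exists a, phi a = x].

(* Subsets of R are boolean predicates, compared extensionally by =i. The     *)
(* library's idealr_closed additionally demands 1 \notin I, i.e. it defines   *)
(* proper ideals; here the unit ideal is allowed.                             *)
Definition is_ideal (R : comNzRingType) (I : {pred R}) : Prop :=
  0 \in I /\ forall a, {in I &, forall u v, a * u + v \in I}.

Definition is_principal (R : comNzRingType) (I : {pred R}) : Prop :=
  exists g, forall x, x \in I <-> exists a, x = a * g.

Definition is_PID (R : idomainType) : Prop :=
  forall I : {pred R}, is_ideal I -> is_principal I.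

Definition is_prime_ideal (R : comNzRingType) (P : {pred R}) : Prop :=
  idealr_closed P /\ prime_idealr_closed P.

Definition is_maximal_ideal (R : comNzRingType) (M : {pred R}) : Prop :=
  idealr_closed M /\
  forall J : {pred R}, is_ideal J -> {subset M <= J} -> J =i M \/ J =i predT.

Definition nonzero_ideal (R : comNzRingType) (I : {pred R}) : Prop :=
  exists2 x, x \in I & x != 0.

Definition unique_nonzero (R : comNzRingType) (C : {pred R} -> Prop) : Prop :=
  exists I : {pred R}, [/\ C I, nonzero_ideal I
    & forall J : {pred R}, C J -> nonzero_ideal J -> J =i I].

(* Main.v *)
Require Import Defs.
From mathcomp Require Import all_boot all_order all_algebra.
From mathcomp Require Import generic_quotient boolp classical_sets.

(** The valuation ring of a discrete valuation is governed by one number: for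
    nonzero a and b, b divides a exactly when the value of b is at most that of
    a.  Hence a nonzero ideal is generated by any of its elements of least
    value, and the only nonzero prime is generated by an element pi of value 1:
    every nonzero element of value n divides pi ^+ n, so a nonzero prime
    contains pi, and every element of value 0 is a unit
    ([dvr_size], [size_PID], [size_unique_prime]).

    In a PID the nonzero primes and the nonzero maximal ideals are the same
    ([maximal_ideal_prime], [PID_prime_maximal]), so the last two conditions
    agree.

    Conversely let p generate the unique nonzero maximal ideal of a PID.  Every
    nonunit lies in some maximal ideal ([krull]), hence is divisible by p.  No
    nonzero element is divisible by all powers of p, so every nonzero
    element is u * p ^+ n with u a unit ([uniformizer_factorization]).  In
    the fraction field every nonzero element is then u * p ^ k for a unique
    integer k, and k is the required valuation ([uniformizer_DVR]). *)

Set Implicit Arguments.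
Unset Strict Implicit.
Unset Printing Implicit Defensive.

Import Order.TTheory GRing.Theory Num.Theory.
Local Open Scope ring_scope.
Local Open Scope quotient_scope.

(** * Ideals of commutative rings *)

Section Ideals.
Variable R : comNzRingType.
Implicit Types (I J M P : {pred R}) (x : R).

Lemma idealr_closed_ideal I : idealr_closed I -> is_ideal I.
Proof. by case. Qed.

Lemma idealr_closed_neq1 I : idealr_closed I -> 1 \notin I.
Proof. by case. Qed.

Lemma ideal_mull I a x : is_ideal I -> x \in I -> a * x \in I.
Proof. by case=> I0 IP xI; rewrite -[_ * _]addr0 IP. Qed.

Lemma ideal1_full I : is_ideal I -> 1 \in I -> I =i predT.
Proof. by move=> Iid I1 x; rewrite -[x]mulr1 (ideal_mull _ Iid I1). Qed.

Definition principal (g : R) : {pred R} := [pred x | `[< exists a, x = a * g >]].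

Lemma principalP g x : reflect (exists a, x = a * g) (x \in principal g).
Proof. exact: asboolP. Qed.

Lemma principal_id g : g \in principal g.
Proof. by apply/principalP; exists 1; rewrite mul1r. Qed.

Lemma principal_ideal g : is_ideal (principal g).
Proof.
split=> [|a u v /principalP[b ->] /principalP[c ->]].
  by apply/principalP; exists 0; rewrite mul0r.
by apply/principalP; exists (a * b + c); rewrite mulrDl mulrA.
Qed.

(** Krull's theorem.  Zorn's lemma is applied to the proper ideals containing
    I together with the empty set, which bounds the empty chain; the latter is
    admitted by putting the conditions under the hypothesis of nonemptiness. *)
Lemma krull I : idealr_closed I ->
  exists2 M, is_maximal_ideal M & {subset I <= M}.
Proof.
case=> I0 I1 IP.
pose good (A : set R) := (A !=set0)%classic ->
  [/\ forall x, x \in I -> A x, ~ A 1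
    & forall a u v, A u -> A v -> A (a * u + v)].
have goodI : good [set x | x \in I]%classic.
  by move=> _; split=> [||a u v] //=; [exact/negP | exact: IP].
have [|A [gA maxA]] := @Zorn_bigcup R good.
  move=> F Fgood Ftot [x [B FB Bx]].
  have Bgood C y (FC : F C) (Cy : C y) := Fgood _ FC (ex_intro _ y Cy).
  split=> [y yI||a u v [C FC Cu] [D FD Dv]].
  - by exists B => //; have [+ _ _] := Bgood B x FB Bx; apply.
  - by case=> C FC C1; have [_ + _] := Bgood C 1 FC C1; apply.
  - have [CD|DC] := Ftot C D FC FD.
      by exists D => //; have [_ _] := Bgood D v FD Dv; apply => //; apply: CD.
    by exists C => //; have [_ _] := Bgood C u FC Cu; apply => //; apply: DC.
have A_neq0 : (A !=set0)%classic.
  apply: contrapT => A0; apply: (maxA _ _ goodI).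
  by split=> [x Ax|/(_ 0 I0) A00]; case: A0; [exists x | exists 0].
have [IA A1 AP] := gA A_neq0.
pose M : {pred R} := [pred x | `[< A x >]].
exists M; last by move=> x xI; apply/asboolP/IA.
split=> [|J Jid AJ].
  split; [exact/asboolP/IA | exact/asboolPn |].
  by move=> a u v /asboolP Au /asboolP Av; apply/asboolP/AP.
have [J1|J1] := boolP (1 \in J); [by right; exact: ideal1_full | left].
suff JA x : x \in J -> A x.
  by move=> x; apply/idP/idP => [/JA Ax|/AJ //]; apply/asboolP.
move=> xJ; apply: contrapT => nAx; apply: (maxA [set y | y \in J]%classic).
  by split=> [y Ay|/(_ x xJ)//]; apply/AJ/asboolP.
move=> _; split=> [y yI||a u v uJ vJ]; [|exact/negP|by case: Jid => _; exact].
by apply/AJ/asboolP/IA.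
Qed.

(** If u is not in M, then M + (u) is the whole ring, so 1 = a * u + m and
    v = a * (u * v) + m * v lies in M as soon as u * v does. *)
Lemma maximal_ideal_prime M : is_maximal_ideal M -> is_prime_ideal M.
Proof.
case=> Mcl Mmax; split=> // u v uvM.
have Mid := idealr_closed_ideal Mcl; have [M0 MP] := Mid.
have [//|/negP uM /=] := boolP (u \in M).
pose J : {pred R} :=
  [pred x | `[< exists a, exists2 m, m \in M & x = a * u + m >]].
have Jid : is_ideal J.
  split=> [|a x y /asboolP[b [m mM ->]] /asboolP[c [n nM ->]]]; apply/asboolP.
    by exists 0, 0; rewrite // mul0r addr0.
  exists (a * b + c), (a * m + n); first exact: MP.
  by rewrite mulrDr mulrDl mulrA addrACA.
have MJ : {subset M <= J}.
  by move=> m mM; apply/asboolP; exists 0, m; rewrite // mul0r add0r.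
case: (Mmax J Jid MJ) => JE.
  case: uM; rewrite -JE; apply/asboolP.
  by exists 1, 0; rewrite // mul1r addr0.
have: 1 \in J by rewrite JE.
case/asboolP=> a [m mM E].
by rewrite -[v]mul1r E mulrDl -mulrA MP // mulrC ideal_mull.
Qed.

End Ideals.

(** * Principal ideal domains *)

Section PID.
Variable R : idomainType.
Hypothesis R_PID : is_PID R.

(** If (p) is prime and (p) is contained in (q), then p = a * q; when p divides
    q the two ideals agree, and when p divides a, cancelling p makes q a unit. *)
Lemma PID_prime_maximal (P : {pred R}) :
  is_prime_ideal P -> nonzero_ideal P -> is_maximal_ideal P.
Proof.
case=> Pcl Pprime [x xP x0]; split=> // J Jid PJ.
have Pid := idealr_closed_ideal Pcl.
have [p Pp] := R_PID Pid; have [q Jq] := R_PID Jid.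
have pP : p \in P by apply/Pp; exists 1; rewrite mul1r.
have qJ : q \in J by apply/Jq; exists 1; rewrite mul1r.
have p0 : p != 0.
  by apply: contraNneq x0 => p0; have [a ->] := (Pp x).1 xP; rewrite p0 mulr0.
have [a pE] := (Jq p).1 (PJ p pP).
have /orP[aP|qP] : (a \in P) || (q \in P) by apply: Pprime; rewrite -pE.
  right; apply: ideal1_full => //.
  have [b aE] := (Pp a).1 aP.
  suff -> : 1 = b * q by exact: ideal_mull.
  by apply: (mulIf p0); rewrite mul1r mulrAC -aE.
left=> y; apply/idP/idP => [/Jq[b ->]|]; [exact: ideal_mull | exact: PJ].
Qed.

(** These conditions say that the nonunits form the ideal generated by p, so
    that p generates the only nonzero maximal ideal. *)
Definition uniformizer (p : R) : Prop :=
  [/\ p != 0, p \isn't a GRing.unit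
    & forall x, x \isn't a GRing.unit -> exists c, x = c * p].

Lemma local_PID_uniformizer :
  unique_nonzero (@is_maximal_ideal R) -> exists p, uniformizer p.
Proof.
case=> M [[Mcl Mmax] [x xM x0] Muniq].
have Mid := idealr_closed_ideal Mcl.
have [p Mp] := R_PID Mid; exists p.
have pM : p \in M by apply/Mp; exists 1; rewrite mul1r.
split.
- by apply: contraNneq x0 => p0; have [a ->] := (Mp x).1 xM; rewrite p0 mulr0.
- apply: contra (idealr_closed_neq1 Mcl) => /mulVr <-; exact: ideal_mull.
move=> y yU; have [->|y0] := eqVneq y 0; first by exists 0; rewrite mul0r.
have ycl : idealr_closed (principal y).
  have [y0' yP] := principal_ideal y; split=> //.
  apply: contra yU => /principalP[a E].
  by apply/unitrP; exists a; rewrite -E mulrC -E.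
have [N Nmax yN] := krull ycl.
have yN' := yN y (principal_id y).
by apply/Mp; rewrite -(Muniq N Nmax) //; exists y.
Qed.

(** Suppose the nonzero element a is divisible by all powers of p and let g
    generate the ideal of those x with p ^+ n * x in (a) for some n, say
    p ^+ n * g = c * a.  As a = b * p ^+ n.+1 for some b, which is in that
    ideal, g = c * b * p is divisible by g * p, and p is a unit. *)
Lemma uniformizer_factorization p a : uniformizer p -> a != 0 ->
  exists n, exists2 u, u \is a GRing.unit & a = u * p ^+ n.
Proof.
case=> p0 pU pP a0; apply: contrapT => nfact.
have adiv n : exists b, a = b * p ^+ n.
  elim: n => [|n [b E]]; first by exists a; rewrite mulr1.
  have [bU|/pP[c cE]] := boolP (b \is a GRing.unit).
    by case: nfact; exists n, b.
  by exists c; rewrite exprS mulrA -cE.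
pose J : {pred R} := [pred x | `[< exists n c, p ^+ n * x = c * a >]].
have Jid : is_ideal J.
  split=> [|k u v /asboolP[n [c uE]] /asboolP[m [d vE]]]; apply/asboolP.
    by exists 0, 0; rewrite mulr0 mul0r.
  exists (n + m)%N, (p ^+ m * k * c + p ^+ n * d).
  rewrite exprD mulrDr mulrDl -!mulrA -uE -vE; congr (_ + _).
  by rewrite mulrCA; congr (_ * _); rewrite !(mulrCA k).
have [g gP] := R_PID Jid.
have gJ : g \in J by apply/gP; exists 1; rewrite mul1r.
have g0 : g != 0.
  apply: contraNneq a0 => g0; have [|c ->] := (gP a).1.
    by apply/asboolP; exists 0, 1; rewrite expr0.
  by rewrite g0 mulr0.
have /asboolP[n [c gE]] := gJ.
have [b aE] := adiv n.+1.
have [|d bE] := (gP b).1.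
  by apply/asboolP; exists n.+1, 1; rewrite mul1r mulrC.
have gE' : g = c * b * p.
  apply: (mulfI (expf_neq0 n p0)).
  by rewrite gE aE exprS [RHS]mulrC !mulrA.
have E1 : c * d * p = 1.
  apply: (mulIf g0); rewrite mul1r [RHS]gE' bE.
  by rewrite -!mulrA [p * g]mulrC.
by case/negP: pU; apply/unitrP; exists (c * d); rewrite E1 mulrC E1.
Qed.

End PID.

(** * From a uniformizer to a valuation of the fraction field *)

Section Valuation.
Variables (R : idomainType) (p : R).
Hypothesis p_unif : uniformizer p.
Hypothesis p_fact : forall a, a != 0 ->
  exists n, exists2 u, u \is a GRing.unit & a = u * p ^+ n.

Local Notation K := {fraction R}.
Local Notation "x %:F" := (FracField.tofrac x) : ring_scope.

Lemma fractionE (x : K) : exists a b, b != 0 /\ x = a%:F / b%:F.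
Proof.
elim/quotW: x => r; exists \n_r, \d_r; split; first exact: denom_ratioP.
have d0 : (\d_r)%:F != 0 :> K by rewrite tofrac_eq0 denom_ratioP.
apply: (mulIf d0); rewrite divfK //.
unlock FracField.tofrac; rewrite -[LHS]FracField.pi_mul.
apply/eqmodP => /=.
rewrite FracField.equivfE /FracField.mulf.
by rewrite !numden_Ratio ?mulr1 ?oner_eq0 ?denom_ratioP // mulrC.
Qed.

Definition has_value (x : K) (k : int) : Prop :=
  exists2 u, u \is a GRing.unit & x = u%:F * p%:F ^ k.

Lemma uniformizer_frac_neq0 : p%:F != 0 :> K.
Proof. by rewrite tofrac_eq0; case: p_unif. Qed.
Local Notation pF0 := uniformizer_frac_neq0.

Lemma has_value_neq0 x k : has_value x k -> x != 0.
Proof.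
case=> u uU ->; rewrite mulf_neq0 ?expfz_neq0 ?pF0 //.
by rewrite tofrac_eq0; apply: contraTneq uU => ->; rewrite unitr0.
Qed.

Lemma has_valueM x y j k :
  has_value x j -> has_value y k -> has_value (x * y) (j + k).
Proof.
case=> u uU -> [w wU ->]; exists (u * w); first by rewrite unitrM uU.
by rewrite tofracM expfzDr ?pF0 // mulrACA.
Qed.

Lemma tofracV (u : R) : u \is a GRing.unit -> (u^-1)%:F = (u%:F)^-1 :> K.
Proof. by move=> uU; rewrite (rmorphV _ uU). Qed.

Lemma has_valueV x k : has_value x k -> has_value x^-1 (- k).
Proof.
case=> u uU ->; exists u^-1; first by rewrite unitrV.
by rewrite invfM tofracV // invr_expz.
Qed.

Lemma has_value_tofrac a : a != 0 -> exists n : nat, has_value a%:F n%:Z.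
Proof.
by case/p_fact=> n [u uU ->]; exists n, u; rewrite // tofracM tofracXn.
Qed.

Lemma has_value_ex x : x != 0 -> exists k, has_value x k.
Proof.
have [a [b [b0 ->]]] := fractionE x.
have [->|a0] := eqVneq a 0; first by rewrite tofrac0 mul0r eqxx.
have [n an] := has_value_tofrac a0; have [m bm] := has_value_tofrac b0.
by move=> _; exists (n%:Z - m%:Z); exact/has_valueM/has_valueV.
Qed.

(** Were n > 0 a value of 1, the nonunit p would divide 1; a negative value of
    1 becomes positive on passing to the inverse. *)
Lemma has_value1 k : has_value 1 k -> k = 0.
Proof.
have pos n : ~ has_value 1 n.+1%:Z.
  case=> u uU; rewrite -exprnP -tofracXn -tofracM -tofrac1 => /eqP.
  rewrite tofrac_eq exprS => /eqP E.
  have [_ /negP + _] := p_unif; apply; apply/unitrP; exists (u * p ^+ n).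
  by rewrite [p * _]mulrC -mulrA -exprSr exprS -E.
case: k => [[|n]|n] // => [/pos //|/has_valueV].
by rewrite invr1 NegzE opprK => /pos.
Qed.

Lemma has_value_uniq x j k : has_value x j -> has_value x k -> j = k.
Proof.
move=> xj xk; apply/eqP; rewrite -subr_eq0; apply/eqP/has_value1.
by rewrite -(mulfV (has_value_neq0 xj)); exact/has_valueM/has_valueV.
Qed.

Definition value (x : K) : int := xget 0 (has_value x).

Lemma valueP x : x != 0 -> has_value x (value x).
Proof. by move/has_value_ex; exact: xgetPex. Qed.

Lemma valueE x k : has_value x k -> value x = k.
Proof.
by move=> xk; apply: has_value_uniq (xk); apply/valueP/has_value_neq0/xk.
Qed.

Lemma has_value_nat x (n : nat) : has_value x n%:Z -> exists a, a%:F = x.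
Proof. by case=> u _ ->; exists (u * p ^+ n); rewrite tofracM tofracXn. Qed.

Lemma value_ge0P x : x \in valuation_ring value <-> exists a, a%:F = x.
Proof.
rewrite inE; split=> [/orP[/eqP->|]|[a <-]]; first by exists 0; rewrite tofrac0.
  have [->|x0] := eqVneq x 0; first by exists 0; rewrite tofrac0.
  by case: (value x) (valueP x0) => // n xn _; exact: has_value_nat xn.
have [->|a0] := eqVneq a 0; first by rewrite tofrac0 eqxx.
by have [n /valueE ->] := has_value_tofrac a0; rewrite orbT.
Qed.

(** If x has the smaller value j, then (x + y) / p ^ j is in R, and its value
    is nonnegative. *)
Lemma value_add x y : x != 0 -> y != 0 -> x + y != 0 ->
  Num.min (value x) (value y) <= value (x + y).
Proof.
wlog le_xy : x y / value x <= value y.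
  move=> wl x0 y0 xy0; have [le|/ltW le] := leP (value x) (value y).
    by have := wl _ _ le x0 y0 xy0; rewrite min_l.
  by have := wl _ _ le y0 x0; rewrite addrC min_l // => ->.
move=> x0 y0 xy0; rewrite min_l //.
have pk k : has_value (p%:F ^ k) k by exists 1; rewrite ?unitr1 // tofrac1 mul1r.
have pj0 := has_value_neq0 (pk (value x)).
have divR z : z != 0 -> value x <= value z -> exists a, a%:F = z / p%:F ^ value x.
  move=> z0 le; have zj := has_valueM (valueP z0) (has_valueV (pk (value x))).
  by apply/value_ge0P; rewrite inE (valueE zj) subr_ge0 le orbT.
have [[a aE] [b bE]] := (divR x x0 (lexx _), divR y y0 le_xy).
have xyE : x + y = (a + b)%:F * p%:F ^ value x.
  by rewrite tofracD mulrDl aE bE !divfK.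
have ab0 : a + b != 0.
  by apply: contraNneq xy0 => E; rewrite xyE E tofrac0 mul0r.
have [n abn] := has_value_tofrac ab0.
by rewrite xyE (valueE (has_valueM abn (pk _))) lerDr.
Qed.

Lemma uniformizer_DVR : is_DVR R.
Proof.
exists K, value, (@FracField.tofrac R); split; last exact: value_ge0P.
  split=> [x y x0 y0|n|]; last exact: value_add.
    by apply: valueE; apply: has_valueM; exact: valueP.
  have pn : has_value (p%:F ^ n) n by exists 1; rewrite ?unitr1 // tofrac1 mul1r.
  by exists (p%:F ^ n); [exact: has_value_neq0 pn | exact: valueE].
by move=> a b /eqP; rewrite tofrac_eq => /eqP.
Qed.

End Valuation.

(** * Ideals of a discrete valuation ring *)

(** The valuation of a discrete valuation ring, seen as a size on its nonzero
    elements that decides divisibility. *)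
Definition valuation_size (R : idomainType) (w : R -> nat) (pi : R) : Prop :=
  [/\ forall a b, a != 0 -> b != 0 -> w (a * b) = (w a + w b)%N,
      forall a b, a != 0 -> b != 0 -> (w b <= w a)%N -> exists c, a = c * b
    & pi != 0 /\ w pi = 1%N].

Lemma dvr_size (R : idomainType) :
  is_DVR R -> exists w pi, @valuation_size R w pi.
Proof.
case=> K [v [phi [[vM vsurj _] phi_inj phiP]]].
have phi0 a : (phi a == 0) = (a == 0) by rewrite -(inj_eq phi_inj) rmorph0.
have v_ge0 a : a != 0 -> 0 <= v (phi a).
  move=> a0; have : phi a \in valuation_ring v by apply/phiP; exists a.
  by rewrite inE phi0 (negbTE a0).
have [t t0 vt] := vsurj 1.
have [pi piE] : exists pi, phi pi = t by apply/phiP; rewrite inE vt orbT.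
exists (fun a => `|v (phi a)|%N), pi; split=> [a b a0 b0|a b a0 b0|].
- apply/eqP; rewrite -eqz_nat PoszD !gez0_abs ?v_ge0 ?mulf_neq0 //.
  by rewrite rmorphM vM ?phi0.
- rewrite -lez_nat !gez0_abs ?v_ge0 // => le_ba.
  have ab0 : phi a / phi b != 0 by rewrite mulf_neq0 ?invr_neq0 ?phi0.
  have [c cE] : exists c, phi c = phi a / phi b.
    apply/phiP; rewrite inE -(lerD2r (v (phi b))) -vM ?phi0 //.
    by rewrite divfK ?phi0 // add0r le_ba orbT.
  by exists c; apply: phi_inj; rewrite rmorphM cE divfK ?phi0.
- by rewrite -phi0 piE vt.
Qed.

Section Size.
Variables (R : idomainType) (w : R -> nat) (pi : R).
Hypothesis w_size : valuation_size w pi.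

Lemma size_PID : is_PID R.
Proof.
case: w_size => wM wdvd _ I Iid.
have [Inz|I0] := pselect (exists2 x, x \in I & x != 0); last first.
  exists 0 => x; split=> [xI|[a ->]]; last by rewrite mulr0; case: Iid.
  exists 0; rewrite mul0r; apply: contrapT => /eqP x0.
  by case: I0; exists x.
have exn : exists n, `[< exists x, [/\ x \in I, x != 0 & w x = n] >].
  by case: Inz => x xI x0; exists (w x); apply/asboolP; exists x.
case: (ex_minnP exn) => _ /asboolP[g [gI g0 <-]] gmin.
exists g => x; split=> [xI|[a ->]]; last exact: ideal_mull.
have [->|x0] := eqVneq x 0; first by exists 0; rewrite mul0r.
by apply: wdvd => //; apply: gmin; apply/asboolP; exists x.
Qed.

Lemma size1 : w 1 = 0%N.
Proof.
case: w_size => wM _ _; have := wM 1 1 (oner_neq0 _) (oner_neq0 _).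
by rewrite mulr1 -{1}[w 1]addn0 => /addnI.
Qed.

Lemma size_dvd_pi x : x != 0 -> (0 < w x)%N -> exists c, x = c * pi.
Proof. by case: w_size => _ wdvd [pi0 wpi] x0 wx; apply: wdvd; rewrite ?wpi. Qed.

Lemma size_mul_pi a : a != 0 -> w (a * pi) = (w a).+1.
Proof. by case: w_size => wM _ [pi0 wpi] a0; rewrite wM // wpi addn1. Qed.

Lemma size_gt0 (J : {pred R}) x :
  idealr_closed J -> x \in J -> x != 0 -> (0 < w x)%N.
Proof.
move=> Jcl xJ x0; rewrite lt0n; apply: contra (idealr_closed_neq1 Jcl) => /eqP wx.
case: w_size => _ wdvd _.
have [c ->] : exists c, 1 = c * x by apply: wdvd; rewrite ?oner_neq0 ?wx.
exact/ideal_mull/xJ/idealr_closed_ideal.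
Qed.

(** Outside (pi) all sizes are 0, hence so is the size of a product of two
    elements from there, while a nonzero multiple of pi has positive size. *)
Lemma principal_pi_prime : is_prime_ideal (principal pi).
Proof.
have [I0 IP] := principal_ideal pi.
split; first split=> //.
  apply/principalP=> -[c E]; have := size1.
  have c0 : c != 0.
    by apply/eqP=> c0; move/eqP: E; rewrite c0 mul0r oner_eq0.
  by rewrite E size_mul_pi.
move=> u v /principalP[c E]; apply/orP.
have [->|u0] := eqVneq u 0; first by left.
have [->|v0] := eqVneq v 0; first by right.
have c0 : c != 0.
  apply/eqP=> c0; have := mulf_neq0 u0 v0.
  by rewrite E c0 mul0r eqxx.
case: w_size => wM _ _.
have: (0 < w u + w v)%N by rewrite -wM // E size_mul_pi.
rewrite addn_gt0 => /orP[wu|wv]; [left|right]; apply/principalP.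
  exact: size_dvd_pi.
exact: size_dvd_pi.
Qed.

(** Splitting off factors pi one at a time reduces a nonzero element of J to a
    unit, which is not in J; primality of J stops this at pi. *)
Lemma prime_contains_pi (J : {pred R}) :
  is_prime_ideal J -> nonzero_ideal J -> pi \in J.
Proof.
case=> Jcl Jprime [y yJ y0]; move: {2}(w y) (leqnn (w y)) => n.
elim: n y yJ y0 => [|n IHn] y yJ y0 le_yn; have wy := size_gt0 Jcl yJ y0.
  by rewrite ltnNge le_yn in wy.
have [c cE] := size_dvd_pi y0 wy.
have c0 : c != 0 by apply: contraNneq y0 => c0; rewrite cE c0 mul0r.
have /orP[cJ|//] : (c \in J) || (pi \in J) by apply: Jprime; rewrite -cE.
by apply: (IHn c) => //; rewrite -ltnS -size_mul_pi // -cE.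
Qed.

Lemma size_unique_prime : unique_nonzero (@is_prime_ideal R).
Proof.
exists (principal pi); split; first exact: principal_pi_prime.
  by exists pi; [exact: principal_id | case: w_size => _ _ []].
move=> J Jprime Jnz x; have piJ := prime_contains_pi Jprime Jnz.
have [Jcl _] := Jprime; have Jid := idealr_closed_ideal Jcl.
apply/idP/principalP => [xJ|[a ->]]; last exact: ideal_mull.
have [->|x0] := eqVneq x 0; first by exists 0; rewrite mul0r.
exact/size_dvd_pi/(size_gt0 Jcl).
Qed.

End Size.

Theorem corollary12 (R : idomainType) :
  [<-> is_DVR R;
       is_PID R /\ unique_nonzero (@is_prime_ideal R);
       is_PID R /\ unique_nonzero (@is_maximal_ideal R)].
Proof.
tfae=> [/dvr_size[w [pi wpi]]|[R_PID [P [Pprime Pnz Puniq]]]|[R_PID Mex]].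
- by split; [exact: size_PID wpi | exact: size_unique_prime wpi].
- split=> //; exists P; split=> // [|J /maximal_ideal_prime]; last exact: Puniq.
  exact: PID_prime_maximal.
- have [p p_unif] := local_PID_uniformizer R_PID Mex.
  apply: (uniformizer_DVR p_unif) => a.
  exact: uniformizer_factorization.
Qed.
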